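(* The map $\psi:\bigcup_{n\ge0}\mathcal{LF}_n\to\bigcup_{n\ge0}\mathcal{UVD}_{n+1}$ is a bijection with $\mathrm{height}(Q)=\mathrm{vox}(\psi(Q))$ for every labeled $F$-path $Q$.
   Context: **UVD paths.** A UVD path of semilength $n$ is a lattice path from $(0,0)$ to $(2n,0)$ staying weakly above the $x$-axis, with steps $u=(1,1)$, $d=(1,-1)$, $v=(0,-2)$, with no consecutive $uv$ or $vu$, ending with a $d$ step. $\mathcal{UVD}_n$ is the set of these. A return is a $d$ step ending on the $x$-axis; $\mathrm{vox}(S)$ is the number of valleys $du$ of $S$ on the $x$-axis (so a nonempty $S$ has $\mathrm{vox}(S)+1$ returns), and $\mathrm{vox}(\emptyset)=-1$. **Labeled $F$-paths.** Let $F=\{(a,1):a\ge0\}\cup\{(a,b):a\ge1,b\le0\}$ ($a,b$ integers). An $F$-path is a lattice path $(x_0,y_0)=(0,0),(x_1,y_1),\dots,(x_\ell,y_\ell)$ in $\mathbb Z^2$ not going below the line $y=x$ and all of whose steps $(x_j-x_{j-1},y_j-y_{j-1})$ lie in $F$. A labeled $F$-path is an $F$-path in which each step $(a,1)$ has label $(a;1)$, and each step $(a,b)$ with $b\le0$ has a label $(a;b_1,\dots,b_k)$ with $k\ge1$, nonpositive integers $b_i$, $b_1+\cdots+b_k=b$. A step with label $(a;b_1,\dots,b_k)$ has semilength $k$ (a step labeled $(a;1)$ has semilength $1$); the semilength of the path is the sum of semilengths of its steps. $\mathcal{LF}_n$ is the set of labeled $F$-paths of semilength $n$; $\mathrm{height}(Q)=y_\ell-x_\ell$.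 **The map $\psi$** (it sends $\mathcal{LF}_n$ into $\mathcal{UVD}_{n+1}$), defined recursively. The path with no steps is sent to $ud$. For $Q$ with $\ell\ge1$ steps, let $\hat Q$ be $Q$ with its last step removed, $\hat S=\psi(\hat Q)=\hat s_1\hat s_2\cdots\hat s_N$ (word of steps), $\hat h=\mathrm{height}(\hat Q)=\mathrm{vox}(\hat S)$, so $\hat S$ has $\hat h+1$ returns. (1) If the last label is $(a;1)$, let $p$ be the index of the $(\hat h+1-a)$-th return in $\hat S$ ($p=0$ if $\hat h+1-a=0$), $\alpha=\hat s_1\cdots\hat s_p$, $\beta=\hat s_{p+1}\cdots\hat s_N$ (either may be empty); $\psi(Q)=\alpha\,u\,\beta\,d$. (2) If the last label is $(a;b_1,\dots,b_k)$ with $a\ge1$, all $b_i\le0$, let $j_i$ be the index of the $(\hat h+1+b_{i+1}+\cdots+b_k-a)$-th return of $\hat S$ for $i=0,\dots,k$, and let $p$ be the index with $\hat s_p\ne v$, $\hat s_{p+1}=\cdots=\hat s_{j_0-1}=v$, $\hat s_{j_0}=d$. Put $\alpha=\hat s_1\cdots\hat s_p$, $\beta=\hat s_{p+1}\cdots\hat s_{j_0}$, $\sigma_i=\hat s_{j_{i-1}+1}\cdots\hat s_{j_i}$ ($1\le i\le k$, possibly empty), $\tau=\hat s_{j_k+1}\cdots\hat s_N$; $\psi(Q)=\alpha\;u\sigma_1u\;u\sigma_2u\cdots u\sigma_ku\;\tau\;v^k\;\beta$. *)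

(* Defs.v *)
From HB Require Import structures.
From mathcomp Require Export all_boot all_order all_algebra.
From mathcomp Require Export boolp classical_sets functions.

Set Implicit Arguments.
Unset Strict Implicit.
Unset Printing Implicit Defensive.

Import Order.TTheory GRing.Theory Num.Theory.

Local Open Scope ring_scope.
Local Open Scope classical_set_scope.

Definition vertex (w : seq (int * int)) (j : nat) : int * int :=
  \sum_(t <- take j w) t.

(** * UVD paths *)

Variant step := su | sd | sv.

Definition option_of_step (c : step) : option bool :=
  match c with su => Some true | sd => Some false | sv => None end.

Definition step_of_option (o : option bool) : step :=
  match o with Some true => su | Some false => sd | None => sv end.

Lemma option_of_stepK : cancel option_of_step step_of_option.
Proof. by case. Qed.

HB.instance Definition _ := Equality.copy step (can_type option_of_stepK).

Definition vec (c : step) : int * int :=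
  match c with
  | su => (1, 1)
  | sd => (1, -1)
  | sv => (0, -2)
  end.

Definition svertex (s : seq step) (j : nat) : int * int := vertex (map vec s) j.

Definition UVD (n : nat) : set (seq step) :=
  [set s | [/\ svertex s (size s) = ((2 * n)%N%:Z, 0),
               forall j, (j <= size s)%N -> 0 <= (svertex s j).2,
               ~~ infix [:: su; sv] s,
               ~~ infix [:: sv; su] s &
               suffix [:: sd] s]].

(* Steps are numbered from 1, so step j of s is [nth su s j.-1]; it ends at
   [svertex s j]. *)
Definition returns (s : seq step) : seq nat :=
  [seq j <- iota 1 (size s) | (nth su s j.-1 == sd) && ((svertex s j).2 == 0)].

(* The index of the m-th return, and 0 for m = 0.  The index is junk for m < 0
   and for m greater than the number of returns; neither case arises when [psi]
   is applied to a labeled F-path. *)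
Definition return_index (s : seq step) (m : int) : nat :=
  nth 0%N (0%N :: returns s) `|m|%N.

Definition vox (s : seq step) : int :=
  if s is [::] then -1
  else (count (fun j => [&& nth su s j.-1 == sd, (svertex s j).2 == 0,
                            (j < size s)%N & nth su s j == su])
              (iota 1 (size s)))%:Z.

(** * Labeled F-paths *)

Definition F : set (int * int) :=
  [set t | 0 <= t.1 /\ t.2 = 1] `|` [set t | 1 <= t.1 /\ t.2 <= 0].

Definition Fpath (w : seq (int * int)) : Prop :=
  (forall t, t \in w -> F t) /\
  (forall j, (j <= size w)%N -> (vertex w j).1 <= (vertex w j).2).

(* The label (a; b_1, ..., b_k) is the pair (a, [:: b_1; ...; b_k]).  A labeled
   step is represented by its label alone: the step itself is recovered as
   (a, b_1 + ... + b_k). *)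
Definition label : Type := (int * seq int)%type.

Definition is_label (lab : label) : bool :=
  ((0 <= lab.1) && (lab.2 == [:: 1])) ||
  [&& 1 <= lab.1, (1 <= size lab.2)%N & all (fun b : int => b <= 0) lab.2].

Definition step_of_label (lab : label) : int * int :=
  (lab.1, \sum_(b <- lab.2) b).

Definition semilength (Q : seq label) : nat :=
  (\sum_(lab <- Q) size lab.2)%N.

Definition LF (n : nat) : set (seq label) :=
  [set Q | [/\ Fpath (map step_of_label Q), all is_label Q & semilength Q = n]].

Definition height (Q : seq label) : int :=
  (vertex (map step_of_label Q) (size Q)).2 -
  (vertex (map step_of_label Q) (size Q)).1.

(** * The map psi *)

(* s_{p+1} ... s_q *)
Definition factor (s : seq step) (p q : nat) : seq step := drop p (take q s).

(* The index p with s_p <> v and s_{p+1} = ... = s_{j-1} = v. *)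
Definition before_vs (s : seq step) (j : nat) : nat :=
  (j.-1 - find (predC1 sv) (rev (take j.-1 s)))%N.

Definition psi_single (h : int) (a : int) (s : seq step) : seq step :=
  let p := return_index s (h + 1 - a) in
  take p s ++ [:: su] ++ drop p s ++ [:: sd].

Definition psi_multi (h : int) (a : int) (bs : seq int) (s : seq step) :
    seq step :=
  let k := size bs in
  let j i := return_index s (h + 1 + \sum_(b <- drop i bs) b - a) in
  let p := before_vs s (j 0%N) in
  let alpha := take p s in
  let beta := factor s p (j 0%N) in
  let sigma i := factor s (j i.-1) (j i) in
  let tau := drop (j k) s in
  alpha ++ flatten [seq [:: su] ++ sigma i ++ [:: su] | i <- iota 1 k]
        ++ tau ++ nseq k sv ++ beta.

Definition psi_step (h : int) (lab : label) (s : seq step) : seq step :=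
  if lab.2 == [:: 1] then psi_single h lab.1 s else psi_multi h lab.1 lab.2 s.

(* The recursion removes the last label, hence the reversed list. *)
Fixpoint psi_rev (r : seq label) : seq step :=
  if r is lab :: r' then psi_step (height (rev r')) lab (psi_rev r')
  else [:: su; sd].

Definition psi (Q : seq label) : seq step := psi_rev (rev Q).

(* Main.v *)
(** Write a UVD path as a concatenation of its arches.  Undoing one step of psi
on a path [t] other than [ud] means looking at the maximal run of v's before the
final d, [t = x v^n d].  If [n = 0], then [x = s1 u s2] with [s1] and [s2] UVD or
empty, and the last label was [(a; 1)].  If [n > 0], then [x] ends at height
[2n + 1]; cutting it at the last ascents to the heights [2n + 1], [2n], ...
splits off the nonempty top part and then factors [u s_i u], and this stops at
the first remaining prefix [w] that does not end in u or has height 1.  At any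
earlier point [w v^e d] would contain the forbidden factor uv, so the factors,
and with them the last label and the previous path, are determined by [t]. *)

Require Import Defs.
From mathcomp Require Import zify.

Set Implicit Arguments.
Unset Strict Implicit.
Unset Printing Implicit Defensive.

Import Order.TTheory GRing.Theory Num.Theory.

Local Open Scope ring_scope.
Local Open Scope classical_set_scope.

(** * Heights, lengths and a compositional form of UVD words *)

Definition ht (s : seq step) : int := \sum_(c <- s) (vec c).2.

Definition xlen (s : seq step) : int := \sum_(c <- s) (vec c).1.

(** Carrying the starting height lets the condition split along concatenations, which the
    vertex-by-vertex form does not do directly. *)
Fixpoint nonneg_from (h : int) (s : seq step) : bool :=
  (0 <= h) && (if s is c :: s' then nonneg_from (h + (vec c).2) s' else true).

Definition adj (c c' : step) : bool :=
  ((c, c') != (su, sv)) && ((c, c') != (sv, su)).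

(** The default [sd] of [last] admits the empty word, because the pieces between cutting points may
    be empty. The semilength is kept apart and measured by [xlen]. *)
Definition uvd (s : seq step) : bool :=
  [&& nonneg_from 0 s, ht s == 0, sorted adj s & last sd s == sd].

Definition nret (s : seq step) : nat := size (returns s).

Lemma ht0 : ht [::] = 0. Proof. exact: big_nil. Qed.

Lemma ht_cons c s : ht (c :: s) = (vec c).2 + ht s. Proof. exact: big_cons. Qed.

Lemma ht_cat s t : ht (s ++ t) = ht s + ht t. Proof. exact: big_cat. Qed.

Lemma ht_rcons s c : ht (rcons s c) = ht s + (vec c).2.
Proof. by rewrite -cats1 ht_cat ht_cons ht0 addr0. Qed.

Lemma ht_nseq_v k : ht (nseq k sv) = - (2 * k)%:Z.
Proof. by elim: k => [|k IH]; rewrite ?ht0 //= ht_cons IH /=; lia. Qed.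

Definition htE := (ht_cat, ht_cons, ht_rcons, ht_nseq_v, ht0).

Lemma xlen0 : xlen [::] = 0. Proof. exact: big_nil. Qed.

Lemma xlen_cons c s : xlen (c :: s) = (vec c).1 + xlen s.
Proof. exact: big_cons. Qed.

Lemma xlen_cat s t : xlen (s ++ t) = xlen s + xlen t. Proof. exact: big_cat. Qed.

Lemma xlen_nseq_v k : xlen (nseq k sv) = 0.
Proof. by elim: k => [|k IH]; rewrite ?xlen0 //= xlen_cons IH. Qed.

Definition xlenE := (xlen_cat, xlen_cons, xlen_nseq_v, xlen0).

Lemma svertexE s j : svertex s j = (xlen (take j s), ht (take j s)).
Proof.
rewrite /svertex; elim: s j => [|c s IH] [|j];
  rewrite ?take0 ?xlen0 ?ht0 /vertex /= ?big_nil //.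
by rewrite big_cons -/(vertex _ _) IH ht_cons xlen_cons.
Qed.

Lemma nonneg_from_ge0 h s : nonneg_from h s -> 0 <= h.
Proof. by case: s => [|c s] /= /andP[]. Qed.

Lemma nonneg_from_cat h s t :
  nonneg_from h (s ++ t) = nonneg_from h s && nonneg_from (h + ht s) t.
Proof.
elim: s h => [|c s IH] h /=; last by rewrite IH ht_cons addrA andbA.
rewrite ht0 addr0; case E: (nonneg_from h t); last by rewrite andbF.
by rewrite (nonneg_from_ge0 E).
Qed.

Lemma nonneg_from_ht h s : nonneg_from h s -> 0 <= h + ht s.
Proof. by rewrite -[s]cats0 nonneg_from_cat => /andP[_ /=]; rewrite cats0 andbT. Qed.

Lemma nonneg_from_le h h' s : h <= h' -> nonneg_from h s -> nonneg_from h' s.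
Proof.
elim: s h h' => [|c s IH] h h' le_hh' /= /andP[h0]; first by lia.
by move=> H; apply/andP; split; [lia | apply: IH H; lia].
Qed.

Lemma nonneg_from_nseq_v h k : nonneg_from h (nseq k sv) = (0 <= h - (2 * k)%:Z).
Proof.
elim: k h => [|k IH] h /=; first by rewrite subr0 andbT.
by rewrite IH; apply/andP/idP => /=; [case|split]; lia.
Qed.

Lemma nonneg_fromP h s :
  reflect (forall j, (j <= size s)%N -> 0 <= h + ht (take j s))
          (nonneg_from h s).
Proof.
apply: (iffP idP) => [H j _|].
  by move: H; rewrite -{1}(cat_take_drop j s) nonneg_from_cat => /andP[/nonneg_from_ht].
elim: s h => [|c s IH] h H /=; first by have := H 0%N isT; rewrite ht0 addr0 andbT.
apply/andP; split; first by have := H 0%N isT; rewrite take0 ht0 addr0.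
by apply: IH => j lej; have := H j.+1 lej; rewrite /= ht_cons addrA.
Qed.

Lemma adj_dr c : adj c sd. Proof. by case: c. Qed.

(** A d may stand next to any step on either side, so the default [sd] makes the junction condition
    vacuous when [s] or [t] is empty. *)
Lemma sorted_adj_cat s t :
  sorted adj (s ++ t) =
  [&& sorted adj s, sorted adj t & adj (last sd s) (head sd t)].
Proof.
case: s => [|c s] /=; first by case: (head sd t); rewrite ?andbT //=.
case: t => [|c' t] /=; first by rewrite cats0 adj_dr andbT.
by rewrite cat_path /= (andbC (adj _ _)).
Qed.

Lemma sorted_adjE s :
  sorted adj s = ~~ infix [:: su; sv] s && ~~ infix [:: sv; su] s.
Proof.
elim: s => [|c s IH] //; rewrite -cat1s sorted_adj_cat IH [LHS]/=.
rewrite !infix_consl; case: s {IH} => [|c' s]; first by case: c.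
rewrite !prefix_cons !prefix0s !andbT.
by case: c; case: c' => /=; rewrite ?andbT ?andbF ?orbF ?orbT.
Qed.

Lemma uvd_nil : uvd [::]. Proof. by rewrite /uvd /= ht0. Qed.

Lemma uvd_ht s : uvd s -> ht s = 0. Proof. by case/and4P=> _ /eqP. Qed.

Lemma uvd_last s : uvd s -> last sd s = sd. Proof. by case/and4P=> _ _ _ /eqP. Qed.

Lemma uvd_head s : uvd s -> s != [::] -> exists s', s = su :: s'.
Proof.
case: s => [|[] s] // => [|/and4P[/= + _ _ _] _|/and4P[/= + _ _ _] _].
- by exists s.
- by move=> /nonneg_from_ge0.
- by move=> /nonneg_from_ge0.
Qed.

Lemma uvd_cat s t : uvd s -> uvd t -> uvd (s ++ t).
Proof.
move=> us /and4P[nt ht' at' lt'].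
have /and4P[ns hs as' ls'] := us.
apply/and4P; split.
- by rewrite nonneg_from_cat ns (eqP hs).
- by rewrite ht_cat (eqP hs) (eqP ht').
- by rewrite sorted_adj_cat as' at' (eqP ls').
- by rewrite last_cat (eqP ls').
Qed.

Lemma uvd_catr s t : uvd s -> uvd (s ++ t) -> uvd t.
Proof.
move=> us /and4P[]; rewrite nonneg_from_cat ht_cat sorted_adj_cat last_cat.
rewrite (uvd_ht us) (uvd_last us) !add0r => /andP[_ nt] h0 /and3P[_ at' _] l.
exact/and4P.
Qed.

Lemma UVDP n s :
  UVD n s <-> [/\ uvd s, s != [::] & xlen s = (2 * n)%N%:Z].
Proof.
rewrite /UVD /= svertexE take_size; split.
  case=> [[xs hs] nn i1 i2 sfx].
  have {sfx}[s' def_s] : exists s', s = rcons s' sd.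
    by move/suffixP: sfx => [s' ->]; exists s'; rewrite cats1.
  split=> //; last by rewrite def_s; case: s' {def_s}.
  apply/and4P; split.
  - by apply/nonneg_fromP=> j /nn; rewrite svertexE add0r.
  - exact/eqP.
  - by rewrite sorted_adjE i1.
  - by rewrite def_s last_rcons.
case=> /and4P[nn /eqP -> + ls] s_n0 ->; rewrite sorted_adjE => /andP[i1 i2].
split=> // [j lej|].
  by rewrite svertexE; move/nonneg_fromP: nn => /(_ j lej); rewrite add0r.
case/lastP: s s_n0 ls {nn i1 i2} => // s c _; rewrite last_rcons => /eqP ->.
by rewrite -cats1 suffix_suffix.
Qed.

(** * Returns and cutting at returns *)

Lemma returns_cat s t :
  returns (s ++ t) = returns s ++
    [seq j <- iota (size s).+1 (size t) |
       (nth su (s ++ t) j.-1 == sd) && ((svertex (s ++ t) j).2 == 0)].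
Proof.
rewrite {1}/returns size_cat iotaD filter_cat add1n; congr (_ ++ _).
apply: eq_in_filter => j; rewrite mem_iota add1n ltnS => /andP[j0 lej].
rewrite !svertexE nth_cat take_cat.
have -> : (j.-1 < size s)%N by lia.
by case: ltnP lej => // + lej => ?; rewrite (eqP (_ : j - size s == 0)%N) ?take0 ?cats0 ?take_oversize //; lia.
Qed.

Lemma nret_cat s t : ht s = 0 -> nret (s ++ t) = (nret s + nret t)%N.
Proof.
move=> hs; rewrite /nret returns_cat size_cat; congr (_ + _)%N.
rewrite -[(size s).+1]addn1 iotaDl filter_map size_map; congr size.
apply: eq_in_filter => j; rewrite mem_iota add1n ltnS => /andP[j0 lej] /=.
rewrite !svertexE /= take_cat nth_cat.
have -> : ((size s + j).-1 < size s)%N = false by lia.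
have -> : (size s + j < size s)%N = false by lia.
have -> : ((size s + j).-1 - size s = j.-1)%N by lia.
by rewrite addKn ht_cat hs add0r.
Qed.

Lemma nret0 : nret [::] = 0%N. Proof. by []. Qed.

Lemma returns_rcons s c :
  returns (rcons s c) =
  returns s ++ if (c == sd) && (ht (rcons s c) == 0) then [:: (size s).+1] else [::].
Proof.
by rewrite -cats1 returns_cat /= svertexE take_oversize ?size_cat ?addn1 // nth_cat ltnn subnn.
Qed.

Lemma nret_rcons s c :
  nret (rcons s c) = (nret s + ((c == sd) && (ht (rcons s c) == 0)))%N.
Proof. by rewrite /nret returns_rcons size_cat; case: ifP. Qed.

(** A nonempty UVD word ends with a return, which is therefore its last one. For the empty word the
    convention that the zeroth return has index 0 gives the same formula. *)
Lemma return_index_cat s t :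
  uvd s -> return_index (s ++ t) (nret s)%:Z = size s.
Proof.
move=> us; rewrite /return_index absz_nat returns_cat -cat_cons nth_cat /= ltnS leqnn.
rewrite /nret nth_last /=; case/lastP: s us => [|s c] // us.
have := uvd_last us; rewrite last_rcons => cd.
by rewrite returns_rcons (uvd_ht us) cd eqxx last_cat size_rcons.
Qed.

Lemma uvd_split s m : uvd s -> (m <= nret s)%N ->
  exists s1 s2, [/\ s = s1 ++ s2, uvd s1, uvd s2 & nret s1 = m].
Proof.
move=> us lem.
have [s1 [s2 [def_s h1 l1 n1]]] : exists s1 s2,
    [/\ s = s1 ++ s2, ht s1 = 0, last sd s1 = sd & nret s1 = m].
  (* The induction passes through prefixes that need not be UVD words, so it tracks only the final
     height, the last step and the returns; the rest is inherited from [s] afterwards. *)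
  elim/last_ind: s lem {us} => [|s c IH].
    by rewrite leqn0 => /eqP ->; exists [::], [::]; rewrite ht0.
  case: (leqP m (nret s)) => [/IH [s1 [s2 [-> h1 l1 n1]]] _|lt_m].
    by exists s1, (rcons s2 c); rewrite rcons_cat.
  rewrite nret_rcons; case E: (_ && _); last by lia.
  move/andP: E => [/eqP -> /eqP h0] lem.
  exists (rcons s sd), [::]; rewrite cats0 last_rcons nret_rcons h0 eqxx.
  by split=> //=; lia.
have /and4P[] := us; rewrite def_s nonneg_from_cat sorted_adj_cat => /andP[nn1 _] _ /and3P[a1 _ _] _.
have us1 : uvd s1 by apply/and4P; rewrite nn1 h1 a1 l1.
by exists s1, s2; split => //; apply: (uvd_catr us1); rewrite -def_s.
Qed.

(* Only a d step can reach the axis: a v step ending there could only be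
   followed by the forbidden u. *)
Lemma nret_gt0 s : uvd s -> (0 < nret s)%N = (s != [::]).
Proof.
case/lastP: s => [|s c] us; first by [].
rewrite nret_rcons (uvd_ht us); have := uvd_last us; rewrite last_rcons => ->.
by rewrite addn1; case: s {us}.
Qed.

(** After a return only u is possible, since d and v would go below the axis. Hence every return
    except the one that ends the word is the bottom of a valley. *)
Lemma vox_nret s : uvd s -> vox s = (nret s)%:Z - 1.
Proof.
move=> us; case: (eqVneq s [::]) => [-> //|s_n0].
have [s' def_s] : exists s', s = rcons s' sd.
  case/lastP: s us s_n0 => // s c us _; exists s.
  by have := uvd_last us; rewrite last_rcons => ->.
pose P j := (nth su s j.-1 == sd) && ((svertex s j).2 == 0).
have -> : vox s = (count (fun j => P j && (j < size s)%N) (iota 1 (size s)))%:Z.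
  rewrite /vox; case E: s s_n0 => [|c s0] // _; apply: (congr1 Posz); rewrite -E.
  apply: eq_in_count => j; rewrite mem_iota add1n ltnS => /andP[j0 lej].
  rewrite /P -!andbA; case: (boolP (nth _ _ _ == _)) => //= /eqP nj.
  case: eqP => //= h0; case: ltnP => //= ltj.
  have := us; rewrite -{1}(cat_take_drop j s) => /and4P[].
  rewrite nonneg_from_cat sorted_adj_cat => /andP[_] + _ _ _.
  move: h0; rewrite svertexE /= => ->; rewrite addr0.
  by rewrite (drop_nth su ltj) /=; case: (nth su s j) => [//||] /nonneg_from_ge0.
have -> : nret s = count P (iota 1 (size s)) by rewrite /nret size_filter.
have sz : size s = (size s').+1 by rewrite def_s size_rcons.
have -> : iota 1 (size s) = rcons (iota 1 (size s')) (size s).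
  by rewrite {1}sz -[(size s').+1]addn1 iotaD /= add1n -sz cats1.
rewrite -!cats1 !count_cat /= ltnn andbF.
have -> : P (size s).
  by rewrite /P svertexE take_size (uvd_ht us) eqxx nth_last def_s last_rcons.
rewrite (_ : count _ (iota 1 (size s')) = count P (iota 1 (size s'))); first by lia.
apply: eq_in_count => j; rewrite mem_iota add1n ltnS => /andP[j0 lej].
by rewrite sz ltnS lej andbT.
Qed.

(** * One step of the map as a relation *)

(* One step of psi with the cutting points made explicit: the words [s1 ++ s2]
   and [w ++ v^e ++ d ++ flatten ss ++ t] are cut at returns, and [w], [v^e ++ d],
   [ss], [t] are the paper's alpha, beta, sigma_i, tau. *)
Inductive psi_rel : label -> seq step -> seq step -> Prop :=
| PsiSingle s1 s2 of uvd s1 & uvd s2 & s1 ++ s2 != [::] :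
    psi_rel ((nret s2)%:Z, [:: 1]) (s1 ++ s2) (s1 ++ su :: s2 ++ [:: sd])
| PsiMulti w e ss t of last su w != sv & uvd (w ++ nseq e sv ++ [:: sd])
    & all uvd ss & (0 < size ss)%N & uvd t & t != [::] :
    psi_rel ((nret t)%:Z, [seq - (nret s)%:Z | s <- ss])
      (w ++ nseq e sv ++ [:: sd] ++ flatten ss ++ t)
      (w ++ flatten [seq su :: rcons s su | s <- ss] ++ t
         ++ nseq (size ss + e) sv ++ [:: sd]).

Lemma uvd_flatten ss : all uvd ss -> uvd (flatten ss).
Proof.
elim: ss => [|s ss IH] /=; first by rewrite uvd_nil.
by case/andP=> us /IH; apply: uvd_cat.
Qed.

Lemma sum_nret_flatten ss : all uvd ss ->
  \sum_(b <- [seq - (nret s)%:Z | s <- ss]) b = - (nret (flatten ss))%:Z.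
Proof.
elim: ss => [|s ss IH] /=; first by rewrite big_nil.
by case/andP=> us /IH H; rewrite big_cons H nret_cat ?uvd_ht // PoszD; lia.
Qed.

Lemma psi_rel_uvd l s t : psi_rel l s t -> uvd s.
Proof.
case=> [s1 s2 u1 u2 _|w e ss t' _ uP uss _ ut _]; first exact: uvd_cat.
have -> : w ++ nseq e sv ++ [:: sd] ++ flatten ss ++ t' =
  (w ++ nseq e sv ++ [:: sd]) ++ flatten ss ++ t' by rewrite -!catA.
by apply: uvd_cat => //; apply: uvd_cat => //; apply: uvd_flatten.
Qed.

Lemma before_vsE w e s : last su w != sv ->
  before_vs (w ++ nseq e sv ++ sd :: s) (size w + e).+1 = size w.
Proof.
move=> lw; rewrite /before_vs /= catA take_size_cat ?size_cat ?size_nseq //.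
rewrite rev_cat rev_nseq find_cat.
have -> : has (predC1 sv) (nseq e sv) = false by rewrite has_nseq andbF.
rewrite size_nseq (_ : find _ (rev w) = 0%N) ?addn0 ?addnK //.
by case/lastP: w lw => // w c; rewrite last_rcons rev_rcons /= => ->.
Qed.

(** A cut made after a UVD prefix is located by the number of returns of that prefix, so the task is
    to check that the indices computed by [psi_step] are these numbers. *)
Lemma psi_rel_step l s t : psi_rel l s t -> psi_step ((nret s)%:Z - 1) l s = t.
Proof.
case: l s t / => [s1 s2 u1 u2 _|w e ss t' lw uP uss ss0 ut _]; rewrite /psi_step /=.
  rewrite /psi_single nret_cat ?uvd_ht // PoszD.
  have -> : (nret s1)%:Z + (nret s2)%:Z - 1 + 1 - (nret s2)%:Z = (nret s1)%:Z by lia.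
  by rewrite return_index_cat // take_size_cat ?drop_size_cat.
have -> : ([seq - (nret s0)%:Z | s0 <- ss] == [:: 1]) = false.
  by case: ss ss0 {uss} => // s0 ss _; apply/eqP => -[]; lia.
rewrite /psi_multi size_map.
set P := w ++ nseq e sv ++ [:: sd] in uP.
have def_s i : w ++ nseq e sv ++ sd :: flatten ss ++ t' =
    (P ++ flatten (take i ss)) ++ flatten (drop i ss) ++ t'.
  by rewrite /P -[in LHS](cat_take_drop i ss) flatten_cat -!catA.
set s := w ++ _ in def_s *.
have uPi i : uvd (P ++ flatten (take i ss)).
  by apply: uvd_cat => //; apply: uvd_flatten; rewrite -(cat_take_drop i ss) all_cat in uss; case/andP: uss.
have udi i : all uvd (drop i ss).
  by rewrite -(cat_take_drop i ss) all_cat in uss; case/andP: uss.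
pose j i := return_index s ((nret s)%:Z - 1 + 1 +
  \sum_(b <- drop i [seq - (nret s0)%:Z | s0 <- ss]) b - (nret t')%:Z).
(* The labels from position [i] on sum to minus the number of returns of the remaining factors.
   Removing these and the returns of [t'] from those of [s] leaves exactly the returns of the
   prefix. *)
have jE i : j i = size (P ++ flatten (take i ss)).
  rewrite /j -map_drop sum_nret_flatten // (def_s i).
  rewrite nret_cat ?uvd_ht // (nret_cat t') ?uvd_ht ?uvd_flatten // !PoszD.
  rewrite -[RHS](return_index_cat (flatten (drop i ss) ++ t')) //.
  by congr return_index; lia.
rewrite -!/(j _).
have takej i : take (j i) s = P ++ flatten (take i ss).
  by rewrite jE (def_s i) take_size_cat.
have dropj i : drop (j i) s = flatten (drop i ss) ++ t'.
  by rewrite jE (def_s i) drop_size_cat.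
have j0 : j 0%N = (size w + e).+1.
  by rewrite jE take0 /= cats0 /P !size_cat size_nseq /= addn1 addnS.
have -> : before_vs s (j 0%N) = size w by rewrite j0 before_vsE.
rewrite dropj drop_oversize // /factor takej take0 /= cats0.
rewrite {1}/s take_size_cat // /P drop_size_cat // -/P.
congr (_ ++ _); rewrite nseqD -!catA; congr (_ ++ _); congr flatten.
rewrite -[1%N]addn0 iotaDl -map_comp -[in RHS](mkseq_nth [::] ss) -map_comp.
apply/eq_in_map => i; rewrite mem_iota add0n => /andP[_ lti].
rewrite [LHS]/= add1n /=.
rewrite -/(j i) -/(j i.+1) takej (take_nth [::]) // -cats1 flatten_cat /= cats0 catA jE drop_size_cat //.
by rewrite cats1.
Qed.

Lemma v_run s : exists w e, s = w ++ nseq e sv /\ last su w != sv.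
Proof.
elim/last_ind: s => [|s c [w [e [-> lw]]]]; first by exists [::], 0%N.
have [->|ncv] := eqVneq c sv.
  by exists w, e.+1; rewrite rcons_cat -cats1 -(nseqD e 1) addn1.
by exists (rcons (w ++ nseq e sv) c), 0%N; rewrite last_rcons cats0.
Qed.

Lemma uvd_split_labels bs s :
    uvd s -> all (fun b : int => b <= 0) bs ->
    0 <= (nret s)%:Z + \sum_(b <- bs) b ->
  exists ss t, [/\ s = flatten ss ++ t, all uvd ss, uvd t &
    bs = [seq - (nret s0)%:Z | s0 <- ss]].
Proof.
elim: bs s => [|b bs IH] s us /=; first by exists [::], s.
case/andP=> b_le0 bs_le0; rewrite big_cons.
set S := \sum_(c <- bs) c => le_sum.
have sum_le0 : S <= 0.
  by rewrite /S big_seq sumr_le0 // => c /(allP bs_le0).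
have [|s1 [s2 [def_s u1 u2 n1]]] := @uvd_split s `|b|%N us; first by lia.
have := le_sum; rewrite def_s nret_cat ?uvd_ht // n1 => le_sum'.
have [|ss [t [def_s2 uss ut def_bs]]] := IH s2 u2 bs_le0; first by rewrite -/S; lia.
exists (s1 :: ss), t; rewrite /= u1 uss -catA -def_s2 -def_bs n1.
by split => //; congr (_ :: _); lia.
Qed.

(** The inequality says that the new height is nonnegative; it provides enough returns for all cuts.
    For a multiple label it also leaves a return in the prefix before the first factor, which thus
    ends in d, while [1 <= a] makes the last piece nonempty. *)
Lemma psi_rel_total l s : uvd s -> s != [::] -> is_label l ->
    0 <= (nret s)%:Z - 1 + \sum_(b <- l.2) b - l.1 ->
  exists t, psi_rel l s t.
Proof.
case: l => a bs us s_n0 /orP[/andP[/= a_ge0 /eqP ->]|/and3P[/= a_ge1 k_gt0 bs_le0]].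
  rewrite big_seq1 => le_a.
  have [|s1 [s2 [def_s u1 u2 n1]]] := @uvd_split s (nret s - `|a|)%N us; first by lia.
  have -> : a = (nret s2)%:Z by move: n1 le_a; rewrite def_s nret_cat ?uvd_ht //; lia.
  by rewrite def_s in s_n0 *; exists (s1 ++ su :: s2 ++ [:: sd]); constructor.
set S := \sum_(c <- bs) c => h_ge0.
have sum_le0 : S <= 0.
  by rewrite /S big_seq sumr_le0 // => c /(allP bs_le0).
have [|P [s2 [def_s uP u2 nP]]] :=
  @uvd_split s (absz ((nret s)%:Z + S - a)%R) us; first by lia.
have ns2 : (nret s)%:Z = (nret P)%:Z + (nret s2)%:Z.
  by rewrite def_s nret_cat ?uvd_ht.
have [|ss [t [def_s2 uss ut def_bs]]] := uvd_split_labels u2 bs_le0; first by rewrite -/S; lia.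
have nt : (nret t)%:Z = a.
  move: ns2; rewrite def_s2 nret_cat ?uvd_ht ?uvd_flatten // PoszD => ns2.
  have := sum_nret_flatten uss; rewrite -def_bs -/S; lia.
have [P' def_P] : exists P', P = rcons P' sd.
  case/lastP: P uP nP {def_s ns2} => [|P' c] uP nP; first by move: nP; rewrite nret0; lia.
  by exists P'; have := uvd_last uP; rewrite last_rcons => ->.
have [w [e [def_P' lw]]] := v_run P'.
have {}def_P : P = w ++ nseq e sv ++ [:: sd] by rewrite def_P def_P' -cats1 catA.
rewrite def_s def_s2 def_P -!catA -nt def_bs; eexists; apply: PsiMulti => //.
- by rewrite -def_P.
- by rewrite -(size_map (fun s => - (nret s)%:Z)) -def_bs.
- by rewrite -nret_gt0 //; lia.
Qed.

(** * The result of one step: UVD property, length and returns *)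

(** Starting one unit lower turns nonnegativity into strict positivity of the true heights, so no
    step of [s] reaches the axis. *)
Lemma nret_cat_above w s :
  nonneg_from (ht w - 1) s -> nret (w ++ s) = nret w.
Proof.
elim/last_ind: s => [|s c IH]; first by rewrite cats0.
rewrite -cats1 nonneg_from_cat => /andP[/IH {}IH /= /andP[_]].
rewrite andbT catA cats1 nret_rcons IH !htE => nn.
by case: eqP => [|_]; rewrite ?andbF ?addn0 //; lia.
Qed.

Lemma nret_cat_v w e : nret (w ++ nseq e sv) = nret w.
Proof.
elim: e => [|e IH]; first by rewrite cats0.
by rewrite -addn1 nseqD catA cats1 nret_rcons IH addn0.
Qed.

Lemma head_uvd_cat s x : uvd s -> head sd (s ++ su :: x) = su.
Proof.
by move=> us; case: (eqVneq s [::]) => [-> //|/(uvd_head us)[s' ->]].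
Qed.

Lemma adj_dl c : adj sd c. Proof. by case: c. Qed.

Lemma sorted_adj_nseq_v k : sorted adj (nseq k sv).
Proof. by case: k => //; elim. Qed.

Lemma adj_ur c : adj c su = (c != sv). Proof. by case: c. Qed.

Lemma uvd_nonneg h s : uvd s -> 0 <= h -> nonneg_from h s.
Proof. by case/and4P=> nn _ _ _ h0; apply: nonneg_from_le nn. Qed.

Lemma uvd_sorted s : uvd s -> sorted adj s.
Proof. by case/and4P. Qed.

Lemma uvd_lift s : uvd s -> uvd (su :: s ++ [:: sd]).
Proof.
move=> us; apply/and4P; split.
- by rewrite /= nonneg_from_cat uvd_nonneg //= uvd_ht.
- by rewrite !htE uvd_ht.
- rewrite -cat1s !sorted_adj_cat (uvd_sorted us) (uvd_last us) /=.
  by case: (eqVneq s [::]) => [-> //|/(uvd_head us)[s' ->]].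
- by rewrite /= last_cat.
Qed.

Lemma nret_lift s : uvd s -> nret (su :: s ++ [:: sd]) = 1%N.
Proof.
move=> us; rewrite -cat_cons cats1 nret_rcons -cat1s nret_cat_above ?uvd_nonneg //.
  by rewrite !htE uvd_ht.
by rewrite !htE.
Qed.

(** Each block climbs by 2 in total, exactly the drop of one v. *)
Definition ascent (ss : seq (seq step)) : seq step :=
  flatten [seq su :: rcons s su | s <- ss].

Lemma ascent_rcons ss s : ascent (rcons ss s) = ascent ss ++ su :: rcons s su.
Proof. by rewrite /ascent map_rcons flatten_rcons. Qed.

Lemma ht_ascent ss : all uvd ss -> ht (ascent ss) = (2 * size ss)%N%:Z.
Proof.
elim/last_ind: ss => [|ss s IH]; first by rewrite ht0.
rewrite all_rcons => /andP[us /IH {}IH].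
by rewrite ascent_rcons !htE IH (uvd_ht us) size_rcons /=; lia.
Qed.

Lemma xlen_ascent ss :
  xlen (ascent ss) = xlen (flatten ss) + (2 * size ss)%N%:Z.
Proof.
elim: ss => [|s ss IH]; first by rewrite xlen0.
by rewrite /ascent /= -cats1 -/(ascent ss) !xlenE IH /=; lia.
Qed.

Lemma nonneg_ascent h ss : 0 <= h -> all uvd ss -> nonneg_from h (ascent ss).
Proof.
move=> h0; elim/last_ind: ss => [|ss s IH] /=; first by rewrite h0.
rewrite all_rcons => /andP[us uss]; rewrite ascent_rcons nonneg_from_cat IH //.
rewrite ht_ascent //= -cats1 nonneg_from_cat uvd_nonneg //= ?(uvd_ht us); lia.
Qed.

Lemma last_ascent c ss : (0 < size ss)%N -> last c (ascent ss) = su.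
Proof.
case/lastP: ss => // ss s _; rewrite ascent_rcons last_cat /=.
by rewrite last_rcons.
Qed.

Lemma sorted_ascent ss : all uvd ss -> sorted adj (ascent ss).
Proof.
elim/last_ind: ss => [|ss s IH] //.
rewrite all_rcons => /andP[us uss]; rewrite ascent_rcons.
have -> : su :: rcons s su = [:: su] ++ s ++ [:: su] by rewrite cats1.
rewrite !sorted_adj_cat (IH uss) (uvd_sorted us) (head_uvd_cat _ us) (uvd_last us).
rewrite [head _ _]/= adj_ur /=.
by case: (posnP (size ss)) => [/size0nil -> //|/last_ascent ->].
Qed.

Lemma head_ascent ss x : (0 < size ss)%N -> head sd (ascent ss ++ x) = su.
Proof. by case: ss. Qed.

(** In the single case the arches of [s2] merge into one. In the multiple case everything inserted
    after [w] stays above the axis, so the result has as many returns as [w ++ nseq e sv ++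
    [:: sd]], and the returns of the factors and of the last piece are lost. *)
Lemma psi_rel_image l s t : psi_rel l s t ->
  [/\ uvd t, t != [::], xlen t = xlen s + (2 * size l.2)%N%:Z &
      (nret t)%:Z = (nret s)%:Z + \sum_(b <- l.2) b - l.1].
Proof.
case: l s t / => [s1 s2 u1 u2 _|w e ss t lw uP uss ss0 ut t_n0].
  split; first by apply: uvd_cat => //; apply: uvd_lift.
  - by case: s1 {u1}.
  - by rewrite !xlenE /=; lia.
  - by rewrite /= big_seq1 !nret_cat ?uvd_ht // nret_lift //; lia.
rewrite -/(ascent ss).
have hP := uvd_ht uP; have hw : ht w = (2 * e)%N%:Z + 1.
  by move: hP; rewrite !htE /=; lia.
have /and4P[nnP _ sP _] := uP.
have [t' def_t] := uvd_head ut t_n0.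
have nn : nonneg_from (ht w - 1) (ascent ss ++ t).
  by rewrite nonneg_from_cat nonneg_ascent ?hw //=; [apply: uvd_nonneg|]; rewrite ?ht_ascent //; lia.
have hT : ht (w ++ ascent ss ++ t ++ nseq (size ss + e) sv ++ [:: sd]) = 0.
  by rewrite !htE hw ht_ascent // (uvd_ht ut) /=; lia.
have lw' : last sd w != sv by case: (w) lw.
split.
- apply/and4P; split; last by rewrite !last_cat.
  + rewrite nonneg_from_cat (catA (ascent ss)) nonneg_from_cat.
    have -> : nonneg_from 0 w by move: nnP; rewrite nonneg_from_cat => /andP[].
    rewrite (nonneg_from_le _ nn) /=; last by lia.
    rewrite nonneg_from_cat nonneg_from_nseq_v !htE hw ht_ascent // (uvd_ht ut) /=.
    by rewrite andbT; apply/and3P; split; lia.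
  + by rewrite hT.
  + rewrite !sorted_adj_cat (uvd_sorted ut) (sorted_ascent uss) (uvd_last ut).
    have -> : sorted adj w by move: sP; rewrite sorted_adj_cat => /andP[].
    rewrite last_ascent // head_ascent // def_t [head _ (su :: _ ++ _)]/=.
    by rewrite sorted_adj_nseq_v adj_dr adj_dl !adj_ur lw'.
- by rewrite -size_eq0 !size_cat /= !addn1 !addnS.
- by rewrite !xlenE xlen_ascent /= size_map; lia.
have -> : w ++ ascent ss ++ t ++ nseq (size ss + e) sv ++ [:: sd] =
    rcons ((w ++ ascent ss ++ t) ++ nseq (size ss + e) sv) sd.
  by rewrite -cats1 -!catA.
rewrite nret_rcons nret_cat_v nret_cat_above //.
have -> : w ++ nseq e sv ++ sd :: flatten ss ++ t =
    (w ++ nseq e sv ++ [:: sd]) ++ flatten ss ++ t by rewrite -!catA.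
rewrite (nret_cat _ hP) (nret_cat t (uvd_ht (uvd_flatten uss))).
rewrite [((_, _) : label).2]/= [((_, _) : label).1]/= (sum_nret_flatten uss).
have -> : w ++ nseq e sv ++ [:: sd] = rcons (w ++ nseq e sv) sd.
  by rewrite -cats1 -catA.
rewrite nret_rcons nret_cat_v -!cats1 -!catA hT hP /=; lia.
Qed.

(** * Inverting one step *)

(* The u step ends the last visit of [s] to heights at most [i]. *)
Lemma up_step_exists i s : 0 <= i -> i < ht s ->
  exists s1 s2, [/\ s = s1 ++ su :: s2, ht s1 = i & nonneg_from 0 s2].
Proof.
move=> i_ge0; elim/last_ind: s => [|s c IH]; first by rewrite ht0; lia.
case: (ltP i (ht s)) => [lt_i|le_i]; rewrite ht_rcons => lt_ic.
  have [s1 [s2 [def_s h1 nn2]]] := IH lt_i.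
  have := nonneg_from_ht nn2; move: lt_ic; rewrite def_s !htE [(vec su).2]/= => lt_ic h2.
  exists s1, (rcons s2 c); rewrite rcons_cat; split => //.
  rewrite -cats1 nonneg_from_cat nn2 /= andbT; apply/andP; split; lia.
by case: c lt_ic => /= ?; [exists s, [::]; rewrite cats1; split => //|..]; lia.
Qed.

(** If the cuts differed, the later one would lie on the tail after the earlier one, one unit below
    the start of that tail, against nonnegativity. *)
Lemma up_step_inj s1 s2 t1 t2 :
    s1 ++ su :: s2 = t1 ++ su :: t2 -> ht s1 = ht t1 ->
    nonneg_from 0 s2 -> nonneg_from 0 t2 -> s1 = t1 /\ s2 = t2.
Proof.
wlog le_st : s1 s2 t1 t2 / (size s1 <= size t1)%N => [IH|].
  move=> e h n1 n2; case/orP: (leq_total (size s1) (size t1)) => le; first exact: IH.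
  by have [||||-> ->] := IH t1 t2 s1 s2 le.
move=> e h nn2 _; have def_t1 := congr1 (take (size t1)) e.
rewrite (take_size_cat _ (erefl (size t1))) take_cat ltnNge le_st /= in def_t1.
case E: (size t1 - size s1)%N def_t1 => [|n] /=.
  rewrite cats0 => def_t1; split=> //; move: e; rewrite def_t1.
  by move/(congr1 (drop (size t1).+1)); rewrite -!cat_rcons !drop_size_cat ?size_rcons.
move=> def_t1; move: h; rewrite -def_t1 !htE /= => h.
have := nn2; rewrite -{1}(cat_take_drop n s2) nonneg_from_cat.
by case/andP=> /nonneg_from_ht; lia.
Qed.

Lemma v_run_inj w w' e e' :
    w ++ nseq e sv = w' ++ nseq e' sv -> last su w != sv -> last su w' != sv ->
  w = w' /\ e = e'.
Proof.
have rcons_v n s : s ++ nseq n.+1 sv = rcons (s ++ nseq n sv) sv.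
  by rewrite -addn1 nseqD catA cats1.
elim: e e' => [|e IH] [|e']; rewrite ?rcons_v ?cats0.
- by [].
- by move=> -> ; rewrite last_rcons.
- by move=> <- _; rewrite last_rcons.
by move/rcons_inj=> [/IH {}IH] l l'; case: IH => // -> ->.
Qed.

(** The word cannot end with u either, because that step would have to start at height -1. *)
Lemma uvd_intro s : nonneg_from 0 s -> ht s = 0 -> sorted adj s ->
  last sd s != sv -> uvd s.
Proof.
move=> nn h0 ss ls; apply/and4P; rewrite nn h0 ss; split => //.
case/lastP: s nn h0 ls {ss} => // s c; rewrite last_rcons -cats1 nonneg_from_cat.
by rewrite !htE; case: c => // /andP[/nonneg_from_ht /=]; lia.
Qed.

Lemma last_neq_sv s : (last su s != sv) = (last sd s != sv).
Proof. by case: s. Qed.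

(** Blocks are peeled off from the right as long as the word ends in u and the height allows it. The
    final alternative is what keeps [w ++ nseq e' sv ++ [:: sd]] free of the factor uv. *)
Lemma ascent_decomp e s : nonneg_from 0 s -> sorted adj s -> last su s != sv ->
    ht s = (2 * e)%N%:Z + 1 ->
  exists w ss e', [/\ s = w ++ ascent ss, e = (size ss + e')%N, all uvd ss,
    last su w != sv & (last su w != su) || (e' == 0%N)].
Proof.
elim: e s => [|e IH] s nn srt ls hs; first by exists s, [::], 0%N; rewrite cats0 orbT.
have [ls'|] := eqVneq (last su s) su; last first.
  by move=> ls'; exists s, [::], e.+1; rewrite cats0 ls' ls.
case/lastP: s nn srt ls hs ls' => [|s c]; first by rewrite ht0; lia.
rewrite last_rcons => + + _ + c_u; rewrite {c}c_u ht_rcons -cats1.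
rewrite nonneg_from_cat sorted_adj_cat adj_ur => /andP[nn _] /and3P[srt _ ls] /= hs.
(* Without its final u the word ends at height 2e+2. Cutting it at its last ascent from 2e+1 makes
   [s2] return to its starting level and leaves [s1] at the height required by the induction. *)
have [s1 [s2 [def_s h1 nn2]]] : exists s1 s2,
    [/\ s = s1 ++ su :: s2, ht s1 = (2 * e)%N%:Z + 1 & nonneg_from 0 s2].
  by apply: up_step_exists; lia.
move: nn srt ls hs; rewrite def_s nonneg_from_cat -cat1s !sorted_adj_cat [head _ _]/= adj_ur.
rewrite !last_cat ht_cat => /andP[nn1 _] /and3P[srt1 /and3P[_ srt2 _] l1] /= l2.
rewrite ht_cons /= => hs.
have us2 : uvd s2.
  apply: uvd_intro => //; last by rewrite -last_neq_sv.
  by lia.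
have [w [ss [e' [-> -> uss lw le]]]] := IH s1 nn1 srt1 (etrans (last_neq_sv s1) l1) h1.
exists w, (rcons ss s2), e'; split => //.
- by rewrite ascent_rcons -!cats1 -!catA.
- by rewrite size_rcons.
- by rewrite all_rcons us2.
Qed.

(** Blocks are compared from the right, each being cut off at a last ascent. If one side runs out of
    blocks first, its remaining prefix ends in u, so its exponent is 0 and the block counts cannot
    balance. *)
Lemma ascent_inj w w' ss ss' e e' :
    w ++ ascent ss = w' ++ ascent ss' ->
    (size ss + e = size ss' + e')%N ->
    ht w = (2 * e)%N%:Z + 1 -> ht w' = (2 * e')%N%:Z + 1 ->
    all uvd ss -> all uvd ss' ->
    (last su w != su) || (e == 0%N) -> (last su w' != su) || (e' == 0%N) ->
  w = w' /\ ss = ss'.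
Proof.
elim/last_ind: ss ss' => [|ss s IH] ss'; case/lastP: ss' => [|ss' s'].
- by rewrite !cats0.
- rewrite ascent_rcons cats0 size_rcons => -> se _ _ _ _.
  by rewrite !last_cat /= last_rcons eqxx => /eqP e0; move: se; rewrite e0 /=; lia.
- rewrite ascent_rcons cats0 size_rcons => <- se _ _ _ _ _.
  by rewrite !last_cat /= last_rcons eqxx => /eqP e0; move: se; rewrite e0 /=; lia.
rewrite !ascent_rcons !size_rcons !all_rcons -!rcons_cons -!rcons_cat.
move=> /rcons_inj[E] se hw hw' /andP[us uss] /andP[us' uss'] lw lw'.
have [] := up_step_inj (etrans (esym (catA _ _ _)) (etrans E (catA _ _ _))).
- by rewrite !ht_cat !ht_ascent // hw hw'; lia.
- exact: uvd_nonneg.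
- exact: uvd_nonneg.
move=> E' ->; have [] := IH ss' E' _ hw hw' uss uss' lw lw'; first by lia.
by move=> -> ->.
Qed.

Lemma single_run s1 s2 :
  s1 ++ su :: s2 ++ [:: sd] = rcons ((s1 ++ su :: s2) ++ nseq 0 sv) sd.
Proof. by rewrite cats0 -cats1 -catA. Qed.

Lemma single_run_last s1 s2 : uvd s2 -> last su (s1 ++ su :: s2) != sv.
Proof.
move=> u2; rewrite last_cat /=.
by case: s2 u2 => // c s2 /uvd_last /= ->.
Qed.

Lemma multi_run w ss t n :
  w ++ ascent ss ++ t ++ nseq n sv ++ [:: sd] =
  rcons ((w ++ ascent ss ++ t) ++ nseq n sv) sd.
Proof. by rewrite -cats1 -!catA. Qed.

Lemma multi_run_last w ss t : uvd t -> t != [::] ->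
  last su (w ++ ascent ss ++ t) != sv.
Proof. by case: t => // c t /uvd_last /= lt _; rewrite !last_cat /= lt. Qed.

Lemma multi_height_last w e : last su w != sv ->
    uvd (w ++ nseq e sv ++ [:: sd]) ->
  ht w = (2 * e)%N%:Z + 1 /\ (last su w != su) || (e == 0%N).
Proof.
move=> lw uP; have hP := uvd_ht uP; have hw : ht w = (2 * e)%N%:Z + 1.
  by move: hP; rewrite !htE /=; lia.
split=> //; move: (uvd_sorted uP); rewrite sorted_adj_cat => /and3P[_ _].
case: e {uP hP} hw => [|e] hw; rewrite ?orbT //= orbF.
(* The default [su] of [last] is harmless: an empty [w] would have height 0. *)
by case: (w) hw => [|c w'] /=; [rewrite ht0; lia | case: (last c w')].
Qed.

(** Both ascents end with a u reaching the same height, below which [t] and [t'] never go, so this u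
    is the last ascent to that height. *)
Lemma multi_run_inj w w' ss ss' t t' n :
    w ++ ascent ss ++ t = w' ++ ascent ss' ++ t' ->
    (0 < size ss)%N -> (0 < size ss')%N -> uvd t -> uvd t' ->
    ht (w ++ ascent ss) = n -> ht (w' ++ ascent ss') = n ->
  w ++ ascent ss = w' ++ ascent ss' /\ t = t'.
Proof.
have tail v rr : (0 < size rr)%N -> exists x, v ++ ascent rr = rcons x su.
  case/lastP: rr => // rr r _; rewrite ascent_rcons -rcons_cons -!rcons_cat.
  by eexists.
rewrite !catA => + k k' ut ut'; have [x ->] := tail w ss k; have [x' ->] := tail w' ss' k'.
rewrite !cat_rcons !ht_rcons => E h h'.
have hx : ht x = ht x' by lia.
by have [-> ->] := up_step_inj E hx (uvd_nonneg ut (lexx 0)) (uvd_nonneg ut' (lexx 0)).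
Qed.

(** The run of v's before the final d is empty in the single case and has length at least [size ss]
    in the multiple case, which rules out the mixed cases. *)
Lemma psi_rel_inj l l' s s' t :
  psi_rel l s t -> psi_rel l' s' t -> l = l' /\ s = s'.
Proof.
case: l s t / => [s1 s2 u1 u2 _|w e ss t lw uP uss ss0 ut t_n0].
  move E: (s1 ++ _) => t H; case: l' s' t / H E =>
      [r1 r2 v1 v2 _|w e ss t lw uP uss ss0 ut t_n0].
    rewrite !single_run !cats0 => /rcons_inj[E].
    have h0 : ht s1 = ht r1 by rewrite !uvd_ht.
    by have [-> ->] := up_step_inj E h0 (uvd_nonneg u2 (lexx 0)) (uvd_nonneg v2 (lexx 0)).
  rewrite single_run -/(ascent ss) multi_run => /rcons_inj[E].
  have [||_] := v_run_inj (e := 0%N) E; [exact: single_run_last|exact: multi_run_last|lia].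
rewrite -/(ascent ss) multi_run.
move E: (rcons _ _) => T H; case: l' s' T / H E =>
    [r1 r2 v1 v2 _|w' e' ss' t' lw' uP' uss' ss0' ut' t_n0'].
  rewrite single_run => /rcons_inj[E].
  have [||_] := v_run_inj (e' := 0%N) E; [exact: multi_run_last|exact: single_run_last|lia].
rewrite -/(ascent ss') multi_run => /rcons_inj[E0].
have [E se] := v_run_inj E0 (multi_run_last w ss ut t_n0) (multi_run_last w' ss' ut' t_n0').
have [hw cw] := multi_height_last lw uP; have [hw' cw'] := multi_height_last lw' uP'.
have h : ht (w ++ ascent ss) = (2 * (size ss + e))%N%:Z + 1.
  by rewrite ht_cat hw ht_ascent //; clear; lia.
have h' : ht (w' ++ ascent ss') = (2 * (size ss + e))%N%:Z + 1.
  by rewrite ht_cat hw' ht_ascent // se; clear; lia.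
have [E' <-] := multi_run_inj E ss0 ss0' ut ut' h h'.
have [ew ess] := ascent_inj E' se hw hw' uss uss' cw cw'.
have ee : e = e' by rewrite ess in se; clear -se; lia.
by rewrite ew ess ee.
Qed.

Lemma psi_rel_onto t : uvd t -> t != [::] -> t != [:: su; sd] ->
  exists l s, is_label l /\ psi_rel l s t.
Proof.
move=> ut t_n0 t_nud.
have [t0 def_t] : exists t0, t = rcons t0 sd.
  case/lastP: t ut t_n0 {t_nud} => // t0 c ut _.
  by exists t0; have := uvd_last ut; rewrite last_rcons => ->.
have [X [n [def_t0 lX]]] := v_run t0.
have def_t' : t = X ++ nseq n sv ++ [:: sd] by rewrite def_t def_t0 -cats1 catA.
have [hX cX] : ht X = (2 * n)%N%:Z + 1 /\ (last su X != su) || (n == 0%N).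
  by apply: multi_height_last; rewrite -?def_t'.
have /and4P[nn _ srt _] := ut.
move: nn srt; rewrite def_t' nonneg_from_cat sorted_adj_cat => /andP[nnX _] /and3P[srtX _ _].
(* The cut is at the last ascent from 2n to 2n+1, so that [s2] starts and ends at the same level. *)
have [Y [s2 [def_X hY nn2]]] :
    exists s1 s2, [/\ X = s1 ++ su :: s2, ht s1 = (2 * n)%N%:Z & nonneg_from 0 s2].
  by apply: up_step_exists; clear -hX; lia.
have h2 : ht s2 = 0 by move: hX; rewrite def_X !htE hY /=; clear; lia.
move: nnX srtX lX; rewrite def_X nonneg_from_cat -cat1s !sorted_adj_cat [head _ _]/= adj_ur.
rewrite !last_cat [last _ [:: su]]/= => /andP[nnY _] /and3P[srtY /and3P[_ srt2 _] lY] l2.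
have u2 : uvd s2 by apply: uvd_intro => //; rewrite -last_neq_sv.
case: n hX hY cX def_t' {def_t0} => [|n] hX hY cX def_t'.
  have uY : uvd Y by apply: uvd_intro.
  exists ((nret s2)%:Z, [:: 1]), (Y ++ s2); split; first by [].
  rewrite -cat1s -!catA; constructor => //; apply: contraNneq t_nud.
  by rewrite def_t' def_X; case: (Y) => //= ->.
(* Otherwise [X] would end in u just before a nonempty run of v's. *)
have s2_n0 : s2 != [::].
  by apply: contraTneq cX; rewrite def_X => ->; rewrite last_cat.
have [] := @ascent_decomp n.+1 (Y ++ [:: su]).
- by rewrite nonneg_from_cat nnY hY.
- by rewrite sorted_adj_cat srtY /= adj_ur lY.
- by rewrite last_cat.
- by rewrite !htE hY /=; clear; lia.
move=> w [ss [e [def_Y def_n uss lw cw]]].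
(* With no block, [w] would be all of [Y ++ [:: su]], ending in u with [e] positive, against the
   stopping condition. *)
have ss_gt0 : (0 < size ss)%N.
  rewrite lt0n; apply: contraTneq cw => /size0nil ss0; move: def_Y def_n.
  by rewrite ss0 cats0 add0n => <- <-; rewrite last_cat.
have hw : ht w = (2 * e)%N%:Z + 1.
  have := congr1 ht def_Y; rewrite !ht_cat ht_ascent // hY htE ht0 /=; clear -def_n; lia.
have uP : uvd (w ++ nseq e sv ++ [:: sd]).
  have : nonneg_from 0 (Y ++ [:: su]) by rewrite nonneg_from_cat nnY hY.
  have : sorted adj (Y ++ [:: su]) by rewrite sorted_adj_cat srtY /= adj_ur lY.
  rewrite def_Y nonneg_from_cat sorted_adj_cat => /and3P[srtw _ _] /andP[nnw _].
  apply/and4P; split.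
  - by rewrite !nonneg_from_cat nnw nonneg_from_nseq_v !htE hw /=; clear; lia.
  - by rewrite !htE hw /=; clear; lia.
  - rewrite !sorted_adj_cat srtw sorted_adj_nseq_v adj_dr /=.
    case: (e) cw => [|e0] /=; first by rewrite adj_dr.
    by rewrite orbF => lwu; case: (w) lwu => //= c w0; case: (last c w0).
  - by rewrite !last_cat.
exists ((nret s2)%:Z, [seq - (nret s)%:Z | s <- ss]).
exists (w ++ nseq e sv ++ [:: sd] ++ flatten ss ++ s2); split.
  rewrite /is_label /= size_map ss_gt0; apply/orP; right; apply/andP; split.
    by rewrite -nret_gt0 // in s2_n0; clear -s2_n0; lia.
  by rewrite all_map; apply/allP => s _ /=; clear; lia.
rewrite -cat1s !catA -[(_ ++ [:: su])]/(Y ++ [:: su]) def_Y -!catA def_n.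
exact: PsiMulti.
Qed.

(** The growth in length drives the induction of [psi_surj]. Together with [s] being nonempty it
    also shows that ud never results from a step, so only the path with no labels yields it. *)
Lemma psi_rel_size l s t : psi_rel l s t -> s != [::] /\ (size s + 2 <= size t)%N.
Proof.
case: l s t / => [s1 s2 _ _ s_n0|w e ss t _ _ _ k_gt0 _ t_n0]; split => //.
- by rewrite !size_cat /= size_cat /= addn1 addn2 !addnS.
- by rewrite -size_eq0 !size_cat /=; clear; lia.
rewrite -/(ascent ss); have : (size (flatten ss) + size ss <= size (ascent ss))%N.
  elim: (ss) => //= s ss' IH; rewrite /ascent /= -/(ascent ss') !size_cat /= size_rcons.
  by clear -IH; lia.
by rewrite !(size_cat, size_nseq) /=; clear -k_gt0; lia.
Qed.

(** * Labeled paths and induction on the last label *)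

Definition valid (Q : seq label) : Prop :=
  Fpath (map step_of_label Q) /\ all is_label Q.

Lemma LFE n Q : LF n Q <-> valid Q /\ semilength Q = n.
Proof. by rewrite /LF /valid /=; split => [[]|[[]]]. Qed.

Lemma label_F l : is_label l -> F (step_of_label l).
Proof.
case: l => a bs /orP[/andP[/= a_ge0 /eqP ->]|/and3P[/= a_ge1 _ bs_le0]].
  by left; rewrite /= big_seq1.
by right; split; rewrite //= big_seq sumr_le0 // => b /(allP bs_le0).
Qed.

Lemma height_rcons Q l :
  height (rcons Q l) = height Q + \sum_(b <- l.2) b - l.1.
Proof.
rewrite /height /vertex -!(size_map step_of_label) !take_size map_rcons.
rewrite -cats1 big_cat big_seq1 /=.
by case: (\sum_(t <- _) t) => x y /=; lia.
Qed.

Lemma semilength_rcons Q l : semilength (rcons Q l) = (semilength Q + size l.2)%N.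
Proof. by rewrite /semilength -cats1 big_cat big_seq1. Qed.

Lemma valid_nil : valid [::].
Proof. by split=> //; split=> // -[|j] _; rewrite /vertex big_nil. Qed.

Lemma valid_rcons Q l :
  valid (rcons Q l) <-> [/\ valid Q, is_label l & 0 <= height (rcons Q l)].
Proof.
have vtx j : (j <= size Q)%N ->
    vertex (map step_of_label (rcons Q l)) j = vertex (map step_of_label Q) j.
  by move=> lej; rewrite map_rcons -cats1 /vertex takel_cat // size_map.
rewrite /valid /Fpath all_rcons !size_map size_rcons; split.
  case=> -[FQ nn] /andP[il aQ]; split => //.
    split=> //; split=> [t tQ|j lej].
      by apply: FQ; rewrite map_rcons mem_rcons inE tQ orbT.
    by rewrite -vtx // nn // ltnW.
  by rewrite /height subr_ge0 size_rcons nn.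
case=> -[[FQ nn] aQ] il; rewrite /height subr_ge0 size_rcons il aQ => hQ.
split=> //; split=> [t|j].
  by rewrite map_rcons mem_rcons inE => /orP[/eqP ->|/FQ //]; apply: label_F.
rewrite leq_eqVlt ltnS => /orP[/eqP -> //|lej].
by rewrite vtx // nn.
Qed.

Lemma psi_nil : psi [::] = [:: su; sd]. Proof. by []. Qed.

Lemma psi_rcons Q l : psi (rcons Q l) = psi_step (height Q) l (psi Q).
Proof. by rewrite /psi rev_rcons /= revK. Qed.

(** The last component is the invariant of the induction: it identifies the height passed to
    [psi_step] with the number of returns minus one, as [psi_rel_step] requires. *)
Lemma psi_uvd Q : valid Q ->
  [/\ uvd (psi Q), psi Q != [::], xlen (psi Q) = (2 * (semilength Q).+1)%N%:Z &
      (nret (psi Q))%:Z = height Q + 1].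
Proof.
elim/last_ind: Q => [_|Q l IH /valid_rcons[/IH [uQ Q_n0 xQ nQ] il]].
  have u0 : uvd [:: su; sd] := uvd_lift uvd_nil.
  rewrite psi_nil; split => //; first by rewrite !xlenE /semilength big_nil.
  by rewrite (nret_lift uvd_nil) /height /vertex big_nil.
rewrite height_rcons => h_ge0.
have hQ : height Q = (nret (psi Q))%:Z - 1 by rewrite nQ addrK.
have [|t r] := psi_rel_total uQ Q_n0 il; first by rewrite -hQ.
have [ut t_n0 xt nt] := psi_rel_image r.
have -> : psi (rcons Q l) = t by rewrite psi_rcons hQ; apply: psi_rel_step.
split => //; first by rewrite xt xQ semilength_rcons; clear; lia.
by rewrite nt nQ; set S := \sum_(b <- l.2) b; clear; lia.
Qed.

Lemma psi_rel_psi Q l : valid (rcons Q l) -> psi_rel l (psi Q) (psi (rcons Q l)).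
Proof.
case/valid_rcons=> /psi_uvd[uQ Q_n0 _ nQ] il; rewrite height_rcons => h_ge0.
have hQ : height Q = (nret (psi Q))%:Z - 1 by rewrite nQ addrK.
have [|t r] := psi_rel_total uQ Q_n0 il; first by rewrite -hQ.
by rewrite psi_rcons hQ (psi_rel_step r).
Qed.

Lemma psi_inj Q Q' : valid Q -> valid Q' -> psi Q = psi Q' -> Q = Q'.
Proof.
have nil_rcons R l : valid (rcons R l) -> psi (rcons R l) <> [:: su; sd].
  move=> /psi_rel_psi/psi_rel_size[]; rewrite -size_eq0 => + + E.
  by rewrite E /=; clear; lia.
elim/last_ind: Q Q' => [|Q l IH] Q'; case/lastP: Q' => [|Q' l'] // vQ vQ' E.
- by case: (nil_rcons _ _ vQ').
- by case: (nil_rcons _ _ vQ).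
have rQ := psi_rel_psi vQ; have := psi_rel_psi vQ'; rewrite -E.
move=> /(psi_rel_inj rQ)[-> EQ]; congr rcons.
by apply: IH EQ; [case/valid_rcons: vQ|case/valid_rcons: vQ'].
Qed.

Lemma psi_surj t : uvd t -> t != [::] -> exists2 Q, valid Q & psi Q = t.
Proof.
have [n] := ubnP (size t); elim: n t => // n IH t; rewrite ltnS => le_t ut t_n0.
have [->|t_nud] := eqVneq t [:: su; sd].
  by exists [::] => //; apply: valid_nil.
have [l [s [il r]]] := psi_rel_onto ut t_n0 t_nud.
have [s_n0 lt_st] := psi_rel_size r.
have lt_sn : (size s < n)%N by clear -lt_st le_t; lia.
have [Q vQ psiQ] := IH s lt_sn (psi_rel_uvd r) s_n0.
have [_ _ _ nQ] := psi_uvd vQ; rewrite psiQ in nQ.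
have hQ : height Q = (nret s)%:Z - 1 by rewrite nQ addrK.
exists (rcons Q l); last by rewrite psi_rcons psiQ hQ; apply: psi_rel_step.
(* The new height is [nret t] minus one, which is nonnegative because a nonempty UVD word has a
   return. *)
apply/valid_rcons; split => //; rewrite height_rcons hQ.
have [_ _ _ nt] := psi_rel_image r.
rewrite -nret_gt0 // in t_n0.
move: nt; set S := \sum_(b <- l.2) b; clear -t_n0; lia.
Qed.

Theorem theorem3p2 :
  [/\ forall n, set_fun (LF n) (UVD n.+1) psi,
      set_bij (\bigcup_n LF n) (\bigcup_n UVD n.+1) psi &
      forall Q, (\bigcup_n LF n) Q -> height Q = vox (psi Q)].
Proof.
have fpsi n : set_fun (LF n) (UVD n.+1) psi.
  by move=> Q /LFE[/psi_uvd[uQ Q_n0 xQ _] <-]; apply/UVDP.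
split=> //; first split.
- by move=> Q [n _ /fpsi ?]; exists n.
- move=> Q Q' /set_mem[n _ /LFE[vQ _]] /set_mem[n' _ /LFE[vQ' _]].
  exact: psi_inj.
- move=> t [n _ /UVDP[ut t_n0 _]]; have [Q vQ <-] := psi_surj ut t_n0.
  by exists Q => //; exists (semilength Q) => //; apply/LFE.
by move=> Q [n _ /LFE[/psi_uvd[uQ _ _ nQ] _]]; rewrite vox_nret // nQ addrK.
Qed.
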